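(* Let $\mathcal{H}$ be a real Hilbert space, let $F:\mathcal{H}\rightrightarrows\mathcal{H}$ be a set-valued mapping, let $v:\mathcal{H}\to\mathcal{H}$ be a single-valued mapping defined on all of $\mathcal{H}$, and let $\gamma\in(0,+\infty)$. Suppose that $\operatorname{ran}v\subseteq\operatorname{ran}(\gamma F+v)$. (i) If the pair $(F,v)$ is monotone and $v$ is injective, then $\operatorname{dom}J_{\gamma F}^v=\mathcal{H}$ and $J_{\gamma F}^v$ is single-valued. (ii) If the pair $(F,v)$ is $\alpha$-strongly monotone for some $\alpha\in(0,+\infty)$, then for all $(x_1,y_1),(x_2,y_2)\in\operatorname{gra}J_{\gamma F}^v$, $$\alpha\gamma\|y_1-y_2\|^2+\|v(y_1)-v(y_2)\|^2\le\langle v(x_1)-v(x_2),v(y_1)-v(y_2)\rangle.$$ Furthermore, if $v$ is $L$-Lipschitz continuous with $L\in(0,+\infty)$, then for all such $(x_1,y_1),(x_2,y_2)$, $$\|v(y_1)-v(y_2)\|\le\frac{1}{1+\alpha\gamma L^{-2}}\|v(x_1)-v(x_2)\|.$$ If, in addition, $v^{-1}$ is well-defined and $\ell$-Lipschitz continuous, then $J_{\gamma F}^v$ is $\frac{\ell L}{1+\alpha\gamma L^{-2}}$-Lipschitz continuous.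
   Context: For a set-valued mapping $F:\mathcal{H}\rightrightarrows\mathcal{H}$: $\operatorname{dom}F=\{x:F(x)\ne\varnothing\}$, $\operatorname{ran}F=\bigcup_{x}F(x)$, $\operatorname{gra}F=\{(x,y): y\in F(x)\}$, $F^{-1}(y)=\{x: y\in F(x)\}$. Warped resolvent: $J_{\gamma F}^v=(\gamma F+v)^{-1}\circ v$, i.e. $J_{\gamma F}^v(x)=\{y: v(x)\in\gamma F(y)+v(y)\}$, a priori set-valued. The pair $(F,v)$ is monotone if $\langle x^*-y^*, v(x)-v(y)\rangle\ge 0$ for all $x,y\in\mathcal{H}$, $x^*\in F(x)$, $y^*\in F(y)$; it is $\alpha$-strongly monotone ($\alpha>0$) if $\langle x^*-y^*, v(x)-v(y)\rangle\ge\alpha\|x-y\|^2$ for all such $x,y,x^*,y^*$. ''$v^{-1}$ is well-defined'' means that $v$ is bijective from $\mathcal{H}$ onto $\mathcal{H}$. *)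

(* Defs.v *)
From HB Require Import structures.
From mathcomp Require Import all_boot all_order all_algebra.
From mathcomp Require Import all_classical all_reals all_analysis.

Set Implicit Arguments.
Unset Strict Implicit.
Unset Printing Implicit Defensive.

Import Order.TTheory GRing.Theory Num.Theory.
Import numFieldNormedType.Exports.

Local Open Scope classical_set_scope.
Local Open Scope ring_scope.

Section SetValued.
Context {T U : Type}.
Implicit Type F : T -> set U.

Definition mdom F : set T := [set x | F x !=set0].

Definition mran F : set U := \bigcup_x F x.

Definition mgra F : set (T * U) := [set p | F p.1 p.2].

Definition minv F : U -> set T := fun y => [set x | F x y].

Definition single_valued F : Prop := forall x, is_subset1 (F x).

End SetValued.

Section Warped.
Context {R : realType} {H : completeNormedModType R}.
Implicit Types (F J : H -> set H) (v : H -> H).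

(* The set-valued mapping gamma F + v. *)
Definition warped_sum (gamma : R) F v : H -> set H :=
  fun x => [set gamma *: u + v x | u in F x].

Definition warped_resolvent (gamma : R) F v : H -> set H :=
  minv (warped_sum gamma F v) \o v.

Definition pair_monotone (dot : {dot H for idfun}) F v : Prop :=
  forall x y xs ys : H, F x xs -> F y ys -> 0 <= dot (xs - ys) (v x - v y).

Definition pair_strongly_monotone (dot : {dot H for idfun}) (alpha : R) F v :
    Prop :=
  forall x y xs ys : H, F x xs -> F y ys ->
    alpha * `|x - y| ^+ 2 <= dot (xs - ys) (v x - v y).

(* A set-valued mapping is k-Lipschitz when it is (identified with) an
   everywhere-defined, single-valued k-Lipschitz mapping. *)
Definition lipschitz_mapping (k : R) J : Prop :=
  exists2 T : H -> H, (forall x, J x = [set T x]) & k.-lipschitz T.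

End Warped.

(* Main.v *)
Require Import Defs.
From HB Require Import structures.
From mathcomp Require Import all_boot all_order all_algebra.
From mathcomp Require Import all_classical all_reals all_analysis.
From mathcomp Require Import lra.

Set Implicit Arguments.
Unset Strict Implicit.
Unset Printing Implicit Defensive.

Import Order.TTheory GRing.Theory Num.Theory.
Import numFieldNormedType.Exports.

Local Open Scope classical_set_scope.
Local Open Scope ring_scope.

(* If v(x_i) = gamma u_i + v(y_i) with u_i in F(y_i), then
   <v(x1) - v(x2), v(y1) - v(y2)>
     = gamma <u1 - u2, v(y1) - v(y2)> + |v(y1) - v(y2)|^2,
   and (strong) monotonicity bounds the first summand from below. Taking
   x1 = x2 gives uniqueness; Cauchy-Schwarz and |v(y1) - v(y2)| <= L |y1 - y2|
   turn the bound into the Lipschitz estimates. *)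

Section WarpedResolvent.
Context {R : realType} {H : completeNormedModType R} (dot : {dot H for idfun}).
Context (norm_dot : forall x : H, `|x| ^+ 2 = dot x x).
Implicit Types (F : H -> set H) (v : H -> H) (gamma alpha L : R) (x y : H).

(* The triangle inequality is part of the norm structure, so expanding
   |x + y|^2 <= (|x| + |y|)^2 suffices. *)
Lemma cauchy_schwarz x y : dot x y <= `|x| * `|y|.
Proof.
have : `|x + y| ^+ 2 <= (`|x| + `|y|) ^+ 2.
  by rewrite lerXn2r ?nnegrE ?addr_ge0 ?normr_ge0 ?ler_normD.
(* The involution is [idfun] and the sign exponent is 0, so the Hermitian form is symmetric. *)
have dotC : dot y x = dot x y by rewrite [LHS]hermC expr0 mul1r.
rewrite norm_dot linearDl !linearDr /= dotC -!norm_dot; lra.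
Qed.

Lemma warped_resolvent_ran gamma F v :
  range v `<=` mran (warped_sum gamma F v) ->
  mdom (warped_resolvent gamma F v) = [set: H].
Proof.
move=> ran_v; apply/seteqP; split=> // x _.
(* Membership of [y] in the resolvent at [x] unfolds to [v x] lying in [warped_sum gamma F v y], so
   the [y] given by [ran_v] is the witness. *)
by have [|y _ ?] := ran_v (v x); [exists x | exists y].
Qed.

Lemma pair_strongly_monotoneW alpha F v : 0 < alpha ->
  pair_strongly_monotone dot alpha F v -> pair_monotone dot F v.
Proof.
move=> a_gt0 monoF x y xs ys Fx Fy; apply: le_trans (monoF _ _ _ _ Fx Fy).
by rewrite mulr_ge0 ?exprn_ge0 ?normr_ge0 ?ltW.
Qed.

(* alpha = 0 is allowed, so that plain monotonicity is the case alpha = 0. *)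
Lemma warped_resolvent_strongly_monotone gamma alpha F v x1 y1 x2 y2 :
  0 < gamma -> pair_strongly_monotone dot alpha F v ->
  warped_resolvent gamma F v x1 y1 -> warped_resolvent gamma F v x2 y2 ->
  alpha * gamma * `|y1 - y2| ^+ 2 + `|v y1 - v y2| ^+ 2
    <= dot (v x1 - v x2) (v y1 - v y2).
Proof.
move=> g_gt0 monoF [u1 Fu1 <-] [u2 Fu2 <-].
have -> : gamma *: u1 + v y1 - (gamma *: u2 + v y2)
    = gamma *: (u1 - u2) + (v y1 - v y2).
  by rewrite opprD addrACA scalerBr.
rewrite linearDl /= [dot (gamma *: _) _]linearZl_LR -norm_dot lerD2r (mulrC alpha) -mulrA ler_pM2l //.
exact: monoF.
Qed.

Lemma warped_resolvent_single_valued gamma F v : 0 < gamma ->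
  pair_monotone dot F v -> injective v ->
  single_valued (warped_resolvent gamma F v).
Proof.
move=> g_gt0 monoF v_inj x y1 y2 Jy1 Jy2.
have mono0 : pair_strongly_monotone dot 0 F v.
  by move=> a b s t Fa Fb; rewrite mul0r; apply: monoF.
have := warped_resolvent_strongly_monotone g_gt0 mono0 Jy1 Jy2.
(* Both values come from the same [x], so the right-hand side vanishes and the square of
   [|v y1 - v y2|] is at most 0. *)
rewrite subrr [dot 0 _]linear0l !mul0r add0r => vy_le0.
apply/v_inj/eqP; rewrite -subr_eq0 -normr_eq0 -sqrf_eq0.
by rewrite eq_le vy_le0 exprn_ge0.
Qed.

Lemma warped_resolvent_contraction gamma alpha L F v x1 y1 x2 y2 :
  0 < gamma -> 0 < alpha -> 0 < L ->
  pair_strongly_monotone dot alpha F v -> L.-lipschitz v ->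
  warped_resolvent gamma F v x1 y1 -> warped_resolvent gamma F v x2 y2 ->
  `|v y1 - v y2| <= (1 + alpha * gamma * L ^- 2)^-1 * `|v x1 - v x2|.
Proof.
move=> g_gt0 a_gt0 L_gt0 monoF v_lip Jy1 Jy2.
have ag_gt0 : 0 < alpha * gamma by rewrite mulr_gt0.
have K_gt0 : 0 < 1 + alpha * gamma * L ^- 2.
  by rewrite ltr_pwDl // mulr_ge0 ?invr_ge0 ?exprn_ge0 ?ltW.
rewrite ler_pdivlMl //.
(* With the zero case split off, the goal can be multiplied by [|v y1 - v y2|], which makes it
   quadratic like the monotonicity estimate. *)
have [->|vy_neq0] := eqVneq `|v y1 - v y2| 0; first by rewrite mulr0.
have vy_gt0 : 0 < `|v y1 - v y2| by rewrite lt_def vy_neq0 normr_ge0.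
rewrite -(ler_pM2r vy_gt0).
have := warped_resolvent_strongly_monotone g_gt0 monoF Jy1 Jy2.
move=> /le_trans/(_ (cauchy_schwarz _ _)); apply: le_trans.
(* Cancelling [|v y1 - v y2| ^+ 2] and the factor [alpha * gamma] leaves the squared Lipschitz bound
   of [v]. *)
rewrite -[leLHS]mulrA -expr2 mulrDl mul1r addrC lerD2r -[leLHS]mulrA ler_pM2l //.
rewrite ler_pdivrMl ?exprn_gt0 // -exprMn lerXn2r ?nnegrE //.
  by rewrite mulr_ge0 // ltW.
exact: (v_lip (y1, y2)).
Qed.

Lemma warped_resolvent_lipschitz gamma alpha L F v (w : H -> H) (l : R) :
  range v `<=` mran (warped_sum gamma F v) ->
  0 < gamma -> 0 < alpha -> 0 < L ->
  pair_strongly_monotone dot alpha F v -> L.-lipschitz v ->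
  cancel v w -> l.-lipschitz w ->
  lipschitz_mapping (l * L / (1 + alpha * gamma * L ^- 2))
    (warped_resolvent gamma F v).
Proof.
move=> ran_v g_gt0 a_gt0 L_gt0 monoF v_lip vK w_lip.
have K_ge0 : 0 <= (1 + alpha * gamma * L ^- 2)^-1.
  by rewrite invr_ge0 addr_ge0 // !mulr_ge0 ?invr_ge0 ?exprn_ge0 ?ltW.
have /choice[T JT] : forall x, exists y, warped_resolvent gamma F v x y.
  by move=> x; have : [set: H] x by []; rewrite -(warped_resolvent_ran ran_v).
exists T => [x|[x1 x2] _ /=].
  apply/seteqP; split=> [y Jy|_ ->]; last exact: JT.
  apply: warped_resolvent_single_valued Jy (JT x) => //.
    exact: pair_strongly_monotoneW monoF.
  exact: can_inj vK.
(* Read through [w], the Lipschitz inverse bounds distances of points by those of their images under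
   [v]. *)
have w_le (a b : H) : `|a - b| <= l * `|v a - v b|.
  by have := w_lip (v a, v b) (conj I I); rewrite /= !vK.
(* Nothing prevents l < 0; this forces H to be trivial. *)
have [l_ge0|l_lt0] := leP 0 l; last first.
  have triv (a b : H) : `|a - b| = 0.
    apply/eqP; rewrite normr_eq0 -normr_le0 (le_trans (w_le a b)) //.
    by rewrite mulr_le0_ge0 // ltW.
  by rewrite !triv mulr0.
(* The constant has three factors: [l] from [w_le], the inverse from the contraction estimate, [L]
   from [v_lip]. *)
apply: le_trans (w_le _ _) _.
rewrite -[l * L / _]mulrA -[leRHS]mulrA ler_wpM2l //.
apply: le_trans
  (warped_resolvent_contraction g_gt0 a_gt0 L_gt0 monoF v_lip (JT x1) (JT x2)) _.
by rewrite [leRHS]mulrAC [leRHS]mulrC ler_wpM2l //; apply: (v_lip (x1, x2)).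
Qed.

End WarpedResolvent.

(* A real Hilbert space is a complete normed R-module H together with an inner
   product dot inducing the norm. *)
Theorem proposition3p6 (R : realType) (H : completeNormedModType R)
    (dot : {dot H for idfun}) (norm_dot : forall x : H, `|x| ^+ 2 = dot x x)
    (F : H -> set H) (v : H -> H) (gamma : R) (gamma_gt0 : 0 < gamma)
    (ran_v : range v `<=` mran (warped_sum gamma F v)) :
  let J := warped_resolvent gamma F v in
  (pair_monotone dot F v -> injective v ->
     mdom J = [set: H] /\ single_valued J) /\
  (forall alpha : R, 0 < alpha -> pair_strongly_monotone dot alpha F v ->
     (forall x1 y1 x2 y2 : H, mgra J (x1, y1) -> mgra J (x2, y2) ->
        alpha * gamma * `|y1 - y2| ^+ 2 + `|v y1 - v y2| ^+ 2
          <= dot (v x1 - v x2) (v y1 - v y2)) /\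
     (forall L : R, 0 < L -> L.-lipschitz v ->
        (forall x1 y1 x2 y2 : H, mgra J (x1, y1) -> mgra J (x2, y2) ->
           `|v y1 - v y2|
             <= (1 + alpha * gamma * L ^- 2)^-1 * `|v x1 - v x2|) /\
        (forall (w : H -> H) (l : R),
           cancel v w -> cancel w v -> l.-lipschitz w ->
           lipschitz_mapping (l * L / (1 + alpha * gamma * L ^- 2)) J))).
Proof.
move=> J; split=> [monoF v_inj|alpha a_gt0 monoF].
  split; first exact: warped_resolvent_ran.
  exact: (warped_resolvent_single_valued norm_dot).
split=> [x1 y1 x2 y2|L L_gt0 v_lip].
  exact: (warped_resolvent_strongly_monotone norm_dot).
split=> [x1 y1 x2 y2|w l vK _ w_lip].
  exact: (warped_resolvent_contraction norm_dot).
exact: (warped_resolvent_lipschitz norm_dot ran_v).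
Qed.
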